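(* The Buck density and the tile density are identical: for every set $X\subseteq\mathbb{N}$, $\mathrm{buck}(X)=\mathrm{tile}(X)$.
   Context: $\mathbb{N}=\{1,2,3,\ldots\}$, $\mathbb{N}_0=\mathbb{N}\cup\{0\}$; for integers $a\le b$, $[a,b]=\{a,a+1,\ldots,b\}$; for $K\subseteq\mathbb{N}_0$ and $a\in\mathbb{N}_0$, $K+a=\{k+a: k\in K\}$ and $aK=\{ak:k\in K\}$. For $C,D\subseteq\mathbb{N}$, $C\subseteq D \bmod \mathbf{f}$ means that $C\subseteq D\cup F$ for some finite set $F\subseteq\mathbb{N}$. The density of $X\subseteq\mathbb{N}$ is $d(X)=\lim_{n\to\infty}|X\cap[1,n]|/n$ (if this limit exists). Let $\mathcal{R}=\left\{\bigcup_{i=1}^n (a_i\mathbb{N}_0+b_i): n\in\mathbb{N},\ a_1,\ldots,a_n,b_1,\ldots,b_n\in\mathbb{N}\right\}$. The Buck density of $X\subseteq\mathbb{N}$ is $\mathrm{buck}(X)=\inf\{d(B): B\in\mathcal{R},\ X\subseteq B\bmod\mathbf{f}\}$. For $r\in\mathbb{N}$ let $\mathcal{T}_r=2^{[0,r-1]}$, and let $\mathcal{T}=\left\{\left(\bigcup_{j=0}^\infty (T+jr)\right)+b : r,b\in\mathbb{N},\ T\in\mathcal{T}_r\right\}\subseteq 2^{\mathbb{N}}$. The tile density of $X\subseteq\mathbb{N}$ is $\mathrm{tile}(X)=\inf\{d(A): A\in\mathcal{T},\ X\subseteq A\bmod\mathbf{f}\}$. *)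

(* Defs.v *)
From mathcomp Require Import all_boot all_order all_algebra.
From mathcomp Require Import finmap.
From mathcomp Require Import all_classical all_reals all_analysis.

Set Implicit Arguments.
Unset Strict Implicit.
Unset Printing Implicit Defensive.

Import Order.TTheory GRing.Theory Num.Theory.
Import numFieldNormedType.Exports.

Local Open Scope classical_set_scope.
Local Open Scope ring_scope.

(* Sets of positive integers are represented as sets of [nat] included in
   [Npos]; the type [nat] itself plays the role of N_0. *)
Definition Npos : set nat := [set n | (0 < n)%N].

Definition int_range (a b : nat) : set nat := [set k | (a <= k <= b)%N].

Definition translate (K : set nat) (a : nat) : set nat :=
  [set (k + a)%N | k in K].

Definition dilate (a : nat) (K : set nat) : set nat :=
  [set (a * k)%N | k in K].

Definition subset_mod_fin (C D : set nat) : Prop :=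
  exists F : set nat, [/\ finite_set F, F `<=` Npos & C `<=` D `|` F].

(* [limn] is total and returns a default value when there is no limit; below,
   density is only applied to eventually periodic sets, which have a density.
   The term at n = 0, where 0^-1 = 0, does not affect the limit. *)
Definition density (R : realType) (X : set nat) : R :=
  limn (fun n => #|` fset_set (X `&` int_range 1 n)|%:R / n%:R : R).

Definition progression_unions : set (set nat) :=
  [set B | exists (n : nat) (a b : 'I_n -> nat),
    [/\ (0 < n)%N, (forall i, Npos (a i)), (forall i, Npos (b i)) &
        B = \bigcup_(i in [set: 'I_n]) translate (dilate (a i) [set: nat]) (b i)]].

Definition buck (R : realType) (X : set nat) : R :=
  inf [set density R B | B in
        [set B | progression_unions B /\ subset_mod_fin X B]].

Definition tile_patterns (r : nat) : set (set nat) :=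
  [set T | T `<=` int_range 0 r.-1].

Definition tilings : set (set nat) :=
  [set A | exists (r b : nat) (T : set nat),
    [/\ Npos r, Npos b, tile_patterns r T &
        A = translate (\bigcup_(j in [set: nat]) translate T (j * r)%N) b]].

Definition tile (R : realType) (X : set nat) : R :=
  inf [set density R A | A in
        [set A | tilings A /\ subset_mod_fin X A]].

(* Main.v *)
Require Import Defs.
From mathcomp Require Import all_boot all_order all_algebra.
From mathcomp Require Import finmap.
From mathcomp Require Import all_classical all_reals all_analysis.
From mathcomp Require Import zify ring lra.

(** Both infima range over densities of eventually periodic sets.  A union of
    progressions is periodic from some point [b] on, with the product of the
    differences as period, so cutting it at [b] gives a tiling
    ([progression_union_tail]).  The cut removes finitely many points, which
    matters neither to inclusion modulo finite sets nor to the density, because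
    the density of an eventually periodic set is the proportion of its points
    in any one late period ([density_periodic]).  Conversely a tiling with a
    nonempty pattern is the union of one progression for each element of the
    pattern ([tiling_progression_union]).

    The two families thus differ only by the empty tiling, which covers [X]
    modulo finite sets exactly when [X] is finite.  In that case the tile
    density is [0], and so is the Buck density: every single progression
    covers [X] modulo finite sets, and its density [1/a] can be made
    arbitrarily small. *)

Import Order.TTheory GRing.Theory Num.Theory.
Import numFieldNormedType.Exports.

Local Open Scope classical_set_scope.

(** * Densities of eventually periodic sets *)

Definition periodic_from (r N : nat) (X : set nat) : Prop :=
  forall n, (N <= n)%N -> X (n + r)%N <-> X n.

Definition window_count (X : set nat) (N r : nat) : nat :=
  (\sum_(i < r) `[< X (N + i)%N >])%N.

Lemma card_initial_segment (X : set nat) (n : nat) :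
  #|` fset_set (X `&` int_range 1 n)| = window_count X 1 n.
Proof.
rewrite /window_count; elim: n => [|n IHn].
  rewrite big_ord0 (_ : _ `&` _ = set0) ?fset_set0 ?cardfs0 //.
  by apply/seteqP; split=> // x [_] /=; rewrite /int_range /=; lia.
rewrite big_ord_recr /= -{}IHn add1n.
have fin m : finite_set (X `&` int_range 1 m).
  apply: (sub_finite_set _ (finite_II m.+1)) => x [_].
  by rewrite /int_range /=; lia.
case: asboolP => Xn; last first.
  rewrite addn0; congr (#|` fset_set _|); apply/seteqP; split=> x [Xx] /=.
    rewrite /int_range /= => xn; split=> //=.
    have : x <> n.+1 by move=> xE; apply: Xn; rewrite -xE.
    by lia.
  by rewrite /int_range /= => xn; split=> //=; lia.
have -> : X `&` int_range 1 n.+1 = n.+1 |` (X `&` int_range 1 n).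
  apply/seteqP; split=> x /=.
    move=> [Xx]; rewrite /int_range /= => xn.
    by have [->|/eqP xn1] := eqVneq x n.+1; [left|right; split=> //; lia].
  move=> [->|[Xx]]; first by split=> //; rewrite /int_range /=; lia.
  by rewrite /int_range /= => xn; split=> //; lia.
rewrite fset_setU1 // cardfsU1 in_fset_set // addnC.
case: (boolP (_ \in _)) => //; rewrite inE => -[_].
by rewrite /int_range /=; lia.
Qed.

Lemma window_countS (X : set nat) (N r : nat) :
  window_count X N r.+1 = (window_count X N r + `[< X (N + r)%N >])%N.
Proof. by rewrite /window_count big_ord_recr. Qed.

Lemma window_countD (X : set nat) (N m n : nat) :
  window_count X N (m + n) = (window_count X N m + window_count X (N + m) n)%N.
Proof.
elim: n => [|n IHn]; first by rewrite /window_count big_ord0 !addn0.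
by rewrite addnS !window_countS IHn !addnA.
Qed.

Lemma window_count_le (X : set nat) (N r : nat) : (window_count X N r <= r)%N.
Proof.
elim: r => [|r IHr]; first by rewrite /window_count big_ord0.
by rewrite window_countS; case: asbool; lia.
Qed.

Lemma eq_window_count (X Y : set nat) (N r : nat) :
  (forall n, (N <= n)%N -> X n <-> Y n) ->
  window_count X N r = window_count Y N r.
Proof.
move=> XY; apply: eq_bigr => i _; congr (nat_of_bool _).
by apply: asbool_equiv_eq; apply: XY; exact: leq_addr.
Qed.

(** Moving the window by one step loses [n] and gains [n + r]. *)
Lemma window_count_periodic (X : set nat) (r N n : nat) :
  periodic_from r N X -> (N <= n)%N ->
  window_count X n r = window_count X N r.
Proof.
move=> perX; elim: n => [|n IHn] Nn.
  by move: Nn; rewrite leqn0 => /eqP ->.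
have [->//|/eqP NSn] := eqVneq N n.+1.
have Nn' : (N <= n)%N by lia.
rewrite -(IHn Nn').
have : window_count X n (1 + r) = window_count X n (r + 1) by rewrite addnC.
rewrite !window_countD /window_count !big_ord_recr !big_ord0 /= !addn0 addn1.
by rewrite (asbool_equiv_eq (perX n Nn')); lia.
Qed.

(** The deviation of [r * count] from linear growth is itself periodic, hence
    bounded by its trivial bound on the first [N + r] terms. *)
Lemma window_count_linear (X : set nat) (r N n : nat) :
  (0 < r)%N -> periodic_from r N X ->
  (r * window_count X 1 n <= window_count X N r * n + r * (N + r) /\
   window_count X N r * n <= r * window_count X 1 n + r * (N + r))%N.
Proof.
move=> r0 perX; have := window_count_le X N r.
set k := window_count X N r => kr.
elim/ltn_ind: n => n IHn.
have [nN|nN] := ltnP n (N + r).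
  by have := window_count_le X 1 n; nia.
have [|] := IHn (n - r)%N; first by lia.
have := window_countD X 1 (n - r) r.
rewrite subnK; last by lia.
rewrite (@window_count_periodic X r N (1 + (n - r))%N perX); last by lia.
by rewrite -/k => ->; nia.
Qed.

Local Open Scope ring_scope.

Lemma density_periodic (R : realType) (X : set nat) (r N : nat) :
  (0 < r)%N -> periodic_from r N X ->
  density R X = (window_count X N r)%:R / r%:R.
Proof.
move=> r0 perX; apply: cvg_lim => //.
set k := window_count X N r; set M : R := (N + r)%:R.
(* The shifted sequence has no division by zero at its first term. *)
rewrite -cvg_shiftS.
have bnd_cvg (s : R) :
    (fun n => k%:R / r%:R + s * M * harmonic n) @ \oo --> (k%:R / r%:R : R).
  rewrite -[X in _ --> X]addr0 -(mulr0 (s * M)).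
  by apply: cvgD; [exact: cvg_cst|apply: cvgM; [exact: cvg_cst|exact: cvg_harmonic]].
apply: (@squeeze_cvgr _ _ _ _ _ _ _ _ _ (bnd_cvg (-1)) (bnd_cvg 1)).
apply: nearW => n /=; rewrite card_initial_segment.
have [] := @window_count_linear X r N n.+1 r0 perX; rewrite -/k.
rewrite -!(ler_nat R) !natrD !natrM -/M.
set c := (window_count X 1 n.+1)%:R; move=> ub lb.
have r0R : 0 < r%:R :> R by rewrite ltr0n.
have n0R : 0 < n.+1%:R :> R by rewrite ltr0n.
have shape s : k%:R / r%:R + s * M / n.+1%:R =
    (k%:R * n.+1%:R + s * (r%:R * M)) / r%:R / n.+1%:R.
  by field; rewrite !gt_eqF.
rewrite !shape !ler_pM2r ?invr_gt0 // ler_pdivrMr // ler_pdivlMr //.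
by apply/andP; split; lra.
Qed.

(** * Tilings and unions of progressions *)

Lemma tilingE (r b : nat) (T : set nat) : (0 < r)%N -> tile_patterns r T ->
  translate (\bigcup_(j in [set: nat]) translate T (j * r)%N) b =
  [set x | (b <= x)%N /\ T ((x - b) %% r)%N].
Proof.
move=> r0 Tr; apply/seteqP; split=> x /=.
  move=> [_ [j _ [t Tt <-]] <-]; split; first exact: leq_addl.
  rewrite addnK addnC modnMDl modn_small //.
  by have := Tr _ Tt; rewrite /int_range /=; lia.
move=> [bx Tx]; exists (x - b)%N; last by rewrite subnK.
exists ((x - b) %/ r)%N => //; exists ((x - b) %% r)%N => //.
by rewrite addnC -divn_eq.
Qed.

Lemma periodic_fromM (r N n j : nat) (X : set nat) :
  periodic_from r N X -> (N <= n)%N -> X (n + j * r)%N <-> X n.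
Proof.
move=> perX Nn; elim: j => [|j IHj]; first by rewrite mul0n addn0.
by rewrite mulSn addnCA addnC -IHj; apply: perX; lia.
Qed.

Lemma tiling_periodic (A : set nat) : tilings A ->
  exists r b : nat, (0 < r)%N /\ periodic_from r b A.
Proof.
move=> [r [b [T [r0 b0 Tr ->]]]]; exists r, b; split=> // n bn.
rewrite tilingE //= -addnBAC // modnDr; split=> -[_ ?]; split=> //.
exact: leq_trans bn (leq_addr _ _).
Qed.

Lemma periodic_tail_tiling (B : set nat) (r b : nat) :
  (0 < r)%N -> (0 < b)%N -> periodic_from r b B ->
  tilings [set x | (b <= x)%N /\ B x].
Proof.
move=> r0 b0 perB.
exists r, b, [set t | (t < r)%N /\ B (b + t)%N]; split=> //.
  by move=> t [tr _]; rewrite /int_range /=; lia.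
rewrite tilingE //; last by move=> t [tr _]; rewrite /int_range /=; lia.
have BE x : (b <= x)%N -> B x <-> B (b + (x - b) %% r)%N.
  move=> bx.
  rewrite -(@periodic_fromM r b _ ((x - b) %/ r) B perB (leq_addr _ _)).
  by rewrite -addnA (addnC (_ %% _)%N) -divn_eq subnKC.
apply/seteqP; split=> x /= [bx].
  by move=> /(BE x bx) Bx; split=> //; split=> //; exact: ltn_pmod.
by move=> [_ /(BE x bx) Bx].
Qed.

Lemma progressionE (a b : nat) :
  translate (dilate a [set: nat]) b = [set x | (b <= x)%N /\ (a %| x - b)%N].
Proof.
apply/seteqP; split=> x /=.
  move=> [_ [k _ <-] <-]; split; first exact: leq_addl.
  by rewrite addnK dvdn_mulr.
move=> [bx /dvdnP [k xE]]; exists (x - b)%N; last exact: subnK.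
by exists k => //; rewrite mulnC.
Qed.

Lemma progression_union_periodic (B : set nat) : progression_unions B ->
  exists r b : nat, [/\ (0 < r)%N, (0 < b)%N & periodic_from r b B].
Proof.
move=> [n [a [b [n0 a0 b0 ->]]]].
exists (\prod_(i < n) a i)%N, (\max_(i < n) b i).+1; split=> //.
  by apply: prodn_gt0 => i; exact: a0.
move=> x xb.
have bix i : (b i <= x)%N.
  by apply: leq_trans (ltnW xb); exact: (@leq_bigmax _ b i).
have dvd_period i : (a i %| \prod_(i < n) a i)%N.
  by rewrite (bigD1 i) //= dvdn_mulr.
split=> -[i _]; rewrite progressionE /= => -[bx dvdx];
    exists i => //; rewrite progressionE /=.
  by split=> //; rewrite -addnBAC // dvdn_addl // in dvdx.
by split; [exact: leq_trans (leq_addr _ _)|rewrite -addnBAC // dvdn_addl].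
Qed.

Lemma progression_unionW (n : nat) (a b : 'I_n -> nat) : (0 < n)%N ->
  (forall i, (0 < a i)%N) -> (forall i, (0 < b i)%N) ->
  progression_unions
    (\bigcup_(i in [set: 'I_n]) translate (dilate (a i) [set: nat]) (b i)).
Proof. by move=> n0 a0 b0; exists n, a, b. Qed.

(** The densities agree because both sets have the same points in the period
    that starts at [b]. *)
Lemma progression_union_tail (R : realType) (B : set nat) :
  progression_unions B ->
  exists b : nat, tilings [set x | (b <= x)%N /\ B x] /\
    density R [set x | (b <= x)%N /\ B x] = density R B.
Proof.
move=> /progression_union_periodic [r [b [r0 b0 perB]]]; exists b.
split; first exact: periodic_tail_tiling perB.
have tailE n : (b <= n)%N -> [set x | (b <= x)%N /\ B x] n <-> B n.
  by move=> bn; split=> [[]|].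
rewrite !(@density_periodic _ _ r b) //; last first.
  move=> n bn; rewrite !tailE //; [exact: perB|exact: leq_trans bn (leq_addr _ _)].
by rewrite (eq_window_count _ _ _ _ tailE).
Qed.

Lemma tiling_progression_union (A : set nat) :
  tilings A -> A !=set0 -> progression_unions A.
Proof.
move=> [r [b [T [r0 b0 Tr ->]]]]; rewrite tilingE //.
move=> [x0 [bx0 Tt0]]; set t0 := ((x0 - b) %% r)%N in Tt0.
(* Residues outside the pattern are given a redundant progression, so that the
   index set is all of ['I_r]. *)
pose t (i : 'I_r) := if `[< T i >] then nat_of_ord i else t0.
have Tt i : T (t i) by rewrite /t; case: asboolP.
have tr i : (t i < r)%N.
  by have := Tr _ (Tt i); rewrite /int_range /=; move: r0; rewrite /Npos /=; lia.
rewrite (_ : [set _ | _] = \bigcup_(i in [set: 'I_r])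
    translate (dilate r [set: nat]) (b + t i)%N).
  by apply: progression_unionW => // i; exact: leq_trans b0 (leq_addr _ _).
apply/seteqP; split=> x /=.
  move=> [bx Tx]; exists (Ordinal (ltn_pmod (x - b)%N r0)) => //.
  rewrite progressionE /= /t /= asboolT // subnDA.
  have := leq_mod (x - b) r => xr; split; first by lia.
  by rewrite -eqn_mod_dvd // modn_mod.
move=> [i _]; rewrite progressionE /= => -[btx].
rewrite subnDA -eqn_mod_dvd; last by lia.
rewrite (modn_small (tr i)) => /eqP xE; split; first by lia.
by rewrite xE; exact: Tt.
Qed.

(** * Comparison of the two infima *)

Lemma density_tiling_ge0 (R : realType) (A : set nat) :
  tilings A -> 0 <= density R A.
Proof.
move=> /tiling_periodic [r [b [r0 perA]]].
by rewrite (@density_periodic _ _ r b) // divr_ge0.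
Qed.

Lemma density_set0 (R : realType) : density R set0 = 0.
Proof.
rewrite (@density_periodic _ _ 1 0) // /window_count big_ord1.
by rewrite asboolF // mul0r.
Qed.

Lemma tilings_set0 : tilings set0.
Proof.
by exists 1%N, 1%N, set0; split=> //; rewrite tilingE //; apply/seteqP; split=> x // [].
Qed.

Lemma density_progression1 (R : realType) (a : nat) :
  density R (translate (dilate a.+1 [set: nat]) 1) = a.+1%:R^-1.
Proof.
rewrite (@density_periodic _ _ a.+1 1) //; last first.
  move=> n n0; rewrite progressionE /= -addnBAC // dvdn_addl //.
  by split=> -[_ ?]; split=> //; lia.
rewrite /window_count big_ord_recl /= big1 => [|i _].
  rewrite asboolT ?div1r // progressionE /=; split=> //.
rewrite asboolF // progressionE /= => -[_].
by rewrite addKn /bump /= => /dvdn_leq; have := ltn_ord i; lia.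
Qed.

Lemma subset_mod_fin_tail (X B : set nat) (b : nat) : X `<=` Npos ->
  subset_mod_fin X B -> subset_mod_fin X [set x | (b <= x)%N /\ B x].
Proof.
move=> X0 [F [finF F0 XBF]]; exists (F `|` [set x | (0 < x < b)%N]); split.
- rewrite finite_setU; split=> //.
  by apply: (sub_finite_set _ (finite_II b)) => x /= /andP[].
- by move=> x [/F0//|/andP[]].
- move=> x Xx; have [Bx|Fx] := XBF x Xx; last by right; left.
  have [bx|xb] := leqP b x; first by left.
  by right; right => /=; rewrite xb andbT; exact: X0.
Qed.

Lemma buck_values_sub_tile_values (R : realType) (X : set nat) : X `<=` Npos ->
  [set density R B | B in [set B | progression_unions B /\ subset_mod_fin X B]]
  `<=` [set density R A | A in [set A | tilings A /\ subset_mod_fin X A]].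
Proof.
move=> X0 _ [B [PB XB] <-].
have [b [tB dB]] := progression_union_tail R B PB.
by exists [set x | (b <= x)%N /\ B x] => //; split=> //; exact: subset_mod_fin_tail.
Qed.

Lemma tile_values_lbound0 (R : realType) (X : set nat) :
  lbound [set density R A | A in [set A | tilings A /\ subset_mod_fin X A]] 0.
Proof. by move=> _ [A [tA _] <-]; exact: density_tiling_ge0. Qed.

Lemma inf_eq0 (R : realType) (S : set R) : lbound S 0 ->
  (forall a : nat, exists2 x, S x & x <= a.+1%:R^-1) -> inf S = 0.
Proof.
move=> S0 Ssmall; apply/eqP; rewrite eq_le; apply/andP; split; last first.
  by have [x Sx _] := Ssmall 0%N; apply: lb_le_inf => //; exists x.
apply/ler_addgt0Pl => e e0; rewrite addr0.
have [a ae] := ltr_add_invr (y := 0) (x := e) e0.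
have [x Sx xa] := Ssmall a; rewrite add0r in ae.
apply: (le_trans _ (ltW ae)); apply: le_trans xa.
by apply: ge_inf => //; exists 0.
Qed.

Lemma finite_subset_mod_fin (X B : set nat) :
  X `<=` Npos -> finite_set X -> subset_mod_fin X B.
Proof. by move=> X0 finX; exists X; split=> // x; right. Qed.

Theorem corollary4p2 (R : realType) (X : set nat) (hX : X `<=` Npos) :
  buck R X = tile R X.
Proof.
have lb0 := @tile_values_lbound0 R X.
have sub := @buck_values_sub_tile_values R X hX.
rewrite /buck /tile.
have [finX|infX] := pselect (finite_set X).
  rewrite !inf_eq0 // => [a|x /sub|a]; last 2 first.
  - exact: lb0.
  - exists (density R (translate (dilate a.+1 [set: nat]) 1)); last first.
      by rewrite density_progression1.
    exists (translate (dilate a.+1 [set: nat]) 1) => //.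
    split; last exact: finite_subset_mod_fin.
    rewrite (_ : translate _ _ = \bigcup_(i in [set: 'I_1])
        translate (dilate a.+1 [set: nat]) 1); first exact: progression_unionW.
    by rewrite bigcup_const //; exists ord0.
  (* For the tile density the empty tiling attains the infimum. *)
  exists 0; last by rewrite invr_ge0.
  exists set0; last exact: density_set0.
  by split; [exact: tilings_set0|exact: finite_subset_mod_fin].
(* The empty tiling does not cover an infinite [X] modulo finite sets, so the
   two sets of densities coincide. *)
congr (inf _); apply/seteqP; split=> // _ [A [tA XA] <-].
exists A => //; split=> //; apply: tiling_progression_union => //.
apply/set0P/eqP => A0; apply: infX; have [F [finF _]] := XA.
by rewrite A0 set0U => /sub_finite_set; apply.
Qed.
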